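(* Let $(G,c,o)$ be a recurrent rooted network with vertex set $V$ and let $h:V\to[0,\infty)$ be a potential on $(G,c,o)$. Then for all $x,y\in V$, $$|h(x)-h(y)|\le R_{\mathrm{eff}}(x\leftrightarrow y).$$
   Context: A network $(G,c)$ is an infinite, connected, locally finite graph $G=(V,E)$ with positive edge weights (conductances) $c_{xy}=c_{yx}$, $xy\in E$; put $c_x=\sum_{z\sim x}c_{xz}$. The network random walk $\{X_n\}$ is the Markov chain on $V$ with transition probabilities $p(x,y)=c_{xy}/c_x$ for $x\sim y$; $\mathbb{P}_x$ is its law started at $x$. The network is recurrent if this walk is recurrent. A rooted network $(G,c,o)$ is a network with a distinguished vertex $o\in V$. The Laplacian of $f:V\to\mathbb{R}$ is $\Delta f(v)=\sum_{x\sim v}c_{vx}(f(x)-f(v))$. A potential on $(G,c,o)$ is a function $h:V\to[0,\infty)$ with $h(o)=0$, $\Delta h(o)=1$ and $\Delta h(v)=0$ for every $v\ne o$. For a recurrent network the effective resistance between vertices $x\neq y$ is $R_{\mathrm{eff}}(x\leftrightarrow y)=\bigl(c_y\,\mathbb{P}_y(\tau_x<\tau_y^+)\bigr)^{-1}$, where $\tau_x=\min\{n\ge 0:X_n=x\}$ and $\tau_y^+=\min\{n\ge 1:X_n=y\}$; and $R_{\mathrm{eff}}(x\leftrightarrow x)=0$. *)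

(* Defs.v *)
From HB Require Import structures.
From mathcomp Require Import all_boot all_order all_algebra.
From mathcomp Require Import all_classical all_reals all_analysis.

Set Implicit Arguments.
Unset Strict Implicit.
Unset Printing Implicit Defensive.

Import Order.TTheory GRing.Theory Num.Theory.

Local Open Scope classical_set_scope.
Local Open Scope ring_scope.

(* [cond] only matters on edges: off the edges its values are junk.  No
   irreflexivity is required of [adj], so simple graphs are covered, and loops
   (counted once in [vcond]) are allowed. *)
Record network (R : realType) (V : choiceType) := Network {
  adj : rel V;
  cond : V -> V -> R;
  adj_sym : symmetric adj;
  adj_infinite : infinite_set [set: V];
  adj_connected : forall x y, exists2 s, path adj x s & last x s = y;
  adj_locally_finite : forall x, finite_set [set y | adj x y];
  cond_gt0 : forall x y, adj x y -> 0 < cond x y;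
  cond_sym : forall x y, adj x y -> cond x y = cond y x
}.

Section Network.
Variables (R : realType) (V : choiceType) (N : network R V).

Definition vcond (x : V) : R := \sum_(z \in [set z | adj N x z]) cond N x z.

Definition trans (x y : V) : R :=
  if adj N x y then cond N x y / vcond x else 0.

Definition laplacian (f : V -> R) (v : V) : R :=
  \sum_(x \in [set x | adj N v x]) cond N v x * (f x - f v).

Definition potential (o : V) (h : V -> R) : Prop :=
  [/\ forall v, 0 <= h v, h o = 0, laplacian h o = 1 &
      forall v, v != o -> laplacian h v = 0].

(* The network random walk, realized on an arbitrary measurable space: [law x]
   is the law of the walk started at [x], [pos n] is X_n, and [V] carries the
   discrete sigma-algebra.  [walk_step] is the Markov property with transition
   probabilities [trans], multiplied out so that histories of probability 0
   need no separate treatment. *)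
Record walk (d : measure_display) (T : measurableType d) := Walk {
  law : V -> probability T R;
  pos : nat -> T -> V;
  walk_measurable : forall n (A : set V), measurable (pos n @^-1` A);
  walk_start : forall x, law x [set w | pos 0 w = x] = 1%E;
  walk_step : forall x n (v : nat -> V),
    law x [set w | forall i, (i <= n.+1)%N -> pos i w = v i] =
    (law x [set w | forall i, (i <= n)%N -> pos i w = v i] *
     (trans (v n) (v n.+1))%:E)%E
}.

Section Walk.
Variables (d : measure_display) (T : measurableType d) (W : walk T).

(* +oo when [S] is empty *)
Definition first_time (S : set nat) : \bar R :=
  ereal_inf [set (n%:R)%:E | n in S].

Definition hit_time (x : V) (w : T) : \bar R :=
  first_time [set n | pos W n w = x].

Definition return_time (x : V) (w : T) : \bar R :=
  first_time [set n | (1 <= n)%N /\ pos W n w = x].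

Definition recurrent : Prop :=
  forall x, law W x [set w | (return_time x w < +oo)%E] = 1%E.

Definition Reff (x y : V) : R :=
  if x == y then 0 else
  (vcond y * fine (law W y [set w | (hit_time x w < return_time y w)%E]))^-1.

End Walk.
End Network.

(* Main.v *)
(* Let S be the one-step operator of the walk killed outside D = V \ {x, y}, so
   that (S^k p(., z))(v) = P_v (X_1, ..., X_k \in D, X_{k+1} = z).  A potential
   satisfies h = h(x) p(., x) + h(y) p(., y) - 1_o / c_o + S h; iterating this at
   x and using S^n h >= 0 gives
     h(y) c_x P_x (tau_y < tau_x^+, n) - h(x) c_x (1 - P_x (tau_x^+ < tau_y, n))
       <= (c_x / c_o) E_x [number of visits to o before n and before the return],
   where n means "within n steps".  By reversibility the right-hand side is
   P_o (tau_x < tau_y, n) <= 1, and c_x P_x (tau_y < tau_x^+) = 1 / R is symmetric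
   in x and y.  By recurrence 1 - P_x (tau_x^+ < tau_y) = P_x (tau_y < tau_x^+),
   so the limit n -> oo reads (h(y) - h(x)) / R <= 1. *)
Require Import Defs.
From mathcomp Require Import all_boot all_order all_algebra.
From mathcomp Require Import all_classical all_reals all_analysis.
From mathcomp Require Import finmap ring lra.

Import Order.TTheory GRing.Theory Num.Theory.
Import numFieldNormedType.Exports.

Local Open Scope ring_scope.

(** * Neighbourhood sums, transition probabilities and detailed balance *)

Section Operators.
Variables (R : realType) (V : choiceType) (N : network R V).
Implicit Types (D : pred V) (f g : V -> R) (v z : V).

(** Listing the neighbours without duplicates turns the finitely supported sums of the definitions
    into ordinary big operators. *)
Definition nbhd v : seq V := fset_set [set z | adj N v z]%classic.

Lemma mem_nbhd v z : (z \in nbhd v) = adj N v z.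
Proof.
by rewrite /nbhd in_fset_set ?mem_setE//; exact: adj_locally_finite.
Qed.

Lemma uniq_nbhd v : uniq (nbhd v).
Proof. exact: fset_uniq. Qed.

Lemma vcondE v : vcond N v = \sum_(z <- nbhd v) cond N v z.
Proof. by rewrite /vcond fsbig_finite//; exact: adj_locally_finite. Qed.

Lemma laplacianE f v :
  laplacian N f v = \sum_(z <- nbhd v) cond N v z * (f z - f v).
Proof. by rewrite /laplacian fsbig_finite//; exact: adj_locally_finite. Qed.

(** Otherwise no path leaves [v], and connectedness reduces [V] to one vertex. *)
Lemma exists_adj v : exists z, adj N v z.
Proof.
apply: contrapT => noadj; apply: (adj_infinite N).
suff -> : [set: V]%classic = [set v]%classic by exact: finite_set1.
apply/seteqP; split => // u _ /=.
have [[|z s] /= + <-//] := adj_connected N v u.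
by case/andP => vz _; case: noadj; exists z.
Qed.

Lemma vcond_gt0 v : 0 < vcond N v.
Proof.
have [z vz] := exists_adj v.
rewrite vcondE (big_rem z) ?mem_nbhd//= ltr_wpDr ?cond_gt0//.
rewrite big_seq sumr_ge0// => u /mem_rem; rewrite mem_nbhd => vu.
exact/ltW/cond_gt0.
Qed.

Lemma vcond_neq0 v : vcond N v != 0.
Proof. by rewrite gt_eqF ?vcond_gt0. Qed.

Lemma trans_ge0 v z : 0 <= trans N v z.
Proof.
rewrite /trans; case: ifPn => // vz.
by rewrite divr_ge0// ltW ?cond_gt0 ?vcond_gt0.
Qed.

Lemma trans_gt0 v z : adj N v z -> 0 < trans N v z.
Proof. by move=> vz; rewrite /trans vz divr_gt0 ?cond_gt0 ?vcond_gt0. Qed.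

Lemma trans_eq0 v z : z \notin nbhd v -> trans N v z = 0.
Proof. by rewrite mem_nbhd /trans => /negbTE ->. Qed.

Lemma detailed_balance v z :
  vcond N v * trans N v z = vcond N z * trans N z v.
Proof.
rewrite /trans (adj_sym N z); case: ifPn => vz; last by rewrite !mulr0.
by rewrite ![vcond N _ * _]mulrC !divfK ?vcond_neq0// cond_sym.
Qed.

Lemma sum_trans v : \sum_(z <- nbhd v) trans N v z = 1.
Proof.
rewrite -[RHS](divff (vcond_neq0 v)) {1}vcondE mulr_suml big_seq [RHS]big_seq.
by apply: eq_bigr => z; rewrite mem_nbhd /trans => ->.
Qed.

(** Both sides reduce to the sum over the common neighbours of [v] and [z], the only places where
    [f] can be nonzero. *)
Lemma sum_nbhd_support v z f : (forall t, t \notin nbhd z -> f t = 0) ->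
  (forall t, t \notin nbhd v -> f t = 0) ->
  \sum_(t <- nbhd v) f t = \sum_(t <- nbhd z) f t.
Proof.
move=> fz fv.
have fE u w : (forall t, t \notin nbhd w -> f t = 0) ->
    \sum_(t <- nbhd u) f t = \sum_(t <- nbhd u | t \in nbhd w) f t.
  by move=> fw; rewrite [RHS]big_mkcond; apply: eq_bigr => t _; case: ifPn => // /fw.
rewrite (fE v z fz) (fE z v fv) -big_filter -[RHS]big_filter; apply: perm_big.
by apply: uniq_perm; rewrite ?filter_uniq ?uniq_nbhd// => t; rewrite !mem_filter andbC.
Qed.

(* [E_v (f (X_1); X_1 \in D)] *)
Definition step D f v : R :=
  \sum_(w <- nbhd v) trans N v w * ((D w)%:R * f w).

(** * Linearity, positivity and splitting of the one-step operator *)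

Lemma eq_step D f g : f =1 g -> step D f =1 step D g.
Proof. by move=> fg v; apply: eq_bigr => w _; rewrite fg. Qed.

Lemma stepD D f g v : step D (f \+ g) v = step D f v + step D g v.
Proof. by rewrite /step -big_split; apply: eq_bigr => w _ /=; ring. Qed.

Lemma stepZ D (a : R) f v : step D (fun u => a * f u) v = a * step D f v.
Proof. by rewrite /step mulr_sumr; apply: eq_bigr => w _ /=; ring. Qed.

Lemma step_ge0 D f : (forall v, 0 <= f v) -> forall v, 0 <= step D f v.
Proof.
by move=> f0 v; apply: sumr_ge0 => w _; rewrite !mulr_ge0 ?trans_ge0.
Qed.

Lemma stepC D f v : step D f v + step (predC D) f v = step predT f v.
Proof.
rewrite /step -big_split; apply: eq_bigr => w _ /=.
by case: (D w) => /=; ring.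
Qed.

Lemma step1 f z v : step (pred1 z) f v = f z * trans N v z.
Proof.
have [vz|vz] := boolP (z \in nbhd v).
  rewrite /step (bigD1_seq z) ?uniq_nbhd//= eqxx big1.
    by rewrite mul1r addr0 mulrC.
  by move=> w /negbTE ->; rewrite mul0r mulr0.
rewrite trans_eq0// mulr0 /step big1_seq// => w /= vw.
by case: eqP => [wz|_]; [rewrite -wz vw in vz|rewrite mul0r mulr0].
Qed.

Lemma step2 f x y v : x != y ->
  step (pred2 x y) f v = f x * trans N v x + f y * trans N v y.
Proof.
move=> xy; rewrite -!step1 /step -big_split; apply: eq_bigr => w _ /=.
have [->|_] := eqVneq w x; last by rewrite /= mul0r mulr0 add0r.
by rewrite (negbTE xy) /=; ring.
Qed.

Lemma step_laplacian f v :
  step predT f v = f v + laplacian N f v / vcond N v.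
Proof.
rewrite laplacianE mulr_suml -[X in _ = X + _]mulr1 -(sum_trans v) mulr_sumr.
rewrite -big_split /step big_seq [RHS]big_seq; apply: eq_bigr => w /=.
by rewrite mem_nbhd /trans => ->; rewrite mul1r; ring.
Qed.

(** * Iterates of the killed step and reversibility of taboo probabilities *)

Lemma eq_iter_step D f g n : f =1 g -> iter n (step D) f =1 iter n (step D) g.
Proof. by move=> fg; elim: n => [|n IH]//=; exact: eq_step. Qed.

Lemma iter_stepD D f g n v :
  iter n (step D) (f \+ g) v = iter n (step D) f v + iter n (step D) g v.
Proof.
by elim: n v => [|n IH] v //=; rewrite (eq_step _ _ _ IH) stepD.
Qed.

Lemma iter_stepZ D (a : R) f n v :
  iter n (step D) (fun u => a * f u) v = a * iter n (step D) f v.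
Proof.
by elim: n v => [|n IH] v //=; rewrite (eq_step _ _ _ IH) stepZ.
Qed.

Lemma iter_step_ge0 D f n v : (forall u, 0 <= f u) -> 0 <= iter n (step D) f v.
Proof. by move=> f0; elim: n v => [|n IH] v //=; exact: step_ge0. Qed.

(** Unrolling the equation [n] times leaves the nonnegative remainder [iter n (step D) f]. This
    serves for the potential and, with [f = 1], for hitting probabilities. *)
Lemma sum_iter_step_le D f g : (forall v, 0 <= f v) -> f =1 g \+ step D f ->
  forall n v, \sum_(0 <= k < n) iter k (step D) g v <= f v.
Proof.
move=> f0 fE n v.
suff -> : f v = \sum_(0 <= k < n) iter k (step D) g v + iter n (step D) f v.
  by rewrite lerDl iter_step_ge0.
elim: n v => [|n IH] v; first by rewrite big_nil add0r.
rewrite IH big_nat_recr//= -addrA; congr (_ + _).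
by rewrite (eq_iter_step D _ _ n fE) iter_stepD -iterSr.
Qed.

(* Last-step decomposition of the taboo probabilities. *)
Lemma iter_step_trans_rev D n v z :
  iter n.+1 (step D) ((trans N)^~ z) v =
  \sum_(t <- nbhd z) iter n (step D) ((trans N)^~ t) v * (D t)%:R * trans N t z.
Proof.
elim: n v => [|n IH] v.
  rewrite /= /step; under [RHS]eq_bigr do rewrite -mulrA.
  apply: sum_nbhd_support => t tN; last by rewrite trans_eq0 ?mul0r.
  by rewrite (trans_eq0 t) ?mulr0// mem_nbhd adj_sym -mem_nbhd.
rewrite iterS {1}/step.
under [LHS]eq_bigr do rewrite IH 2!mulr_sumr.
rewrite exchange_big; apply: eq_bigr => t _ /=.
by rewrite {3}/step 2!mulr_suml; apply: eq_bigr => w _; ring.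
Qed.

(** Under detailed balance a path and its reversal carry the same weight. The induction peels the
    last step on the left-hand side and the first step on the right-hand side. *)
Lemma iter_step_trans_sym D n v z :
  vcond N v * iter n (step D) ((trans N)^~ z) v =
  vcond N z * iter n (step D) ((trans N)^~ v) z.
Proof.
elim: n v z => [|n IH] v z; first exact: detailed_balance.
rewrite iter_step_trans_rev mulr_sumr [in RHS]/= {2}/step mulr_sumr.
apply: eq_bigr => t _; rewrite !mulrA IH [in RHS]detailed_balance; ring.
Qed.

(** The given path alone contributes a positive product of transition probabilities; all other terms
    are nonnegative. *)
Lemma iter_step_gt0 D s v x : path (adj N) v (rcons s x) -> all D s ->
  0 < iter (size s) (step D) ((trans N)^~ x) v.
Proof.
elim: s v => [|w s IH] v /=; first by rewrite andbT => /trans_gt0.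
case/andP => vw p /andP[Dw Ds]; rewrite /step (big_rem w) ?mem_nbhd//=.
rewrite ltr_wpDr ?sumr_ge0// => [u _|].
  rewrite !mulr_ge0 ?trans_ge0 ?iter_step_ge0// => ?; exact: trans_ge0.
by rewrite Dw mul1r mulr_gt0 ?trans_gt0 ?IH.
Qed.

(** A path from [y] to [x] without repeated vertices has its interior outside [{x, y}]. *)
Lemma exists_iter_step_gt0 x y : x != y ->
  exists n, 0 < iter n (step (predC (pred2 x y))) ((trans N)^~ x) y.
Proof.
move=> xy; have [s p] := adj_connected N y x.
case/shortenP: p => s' p u _ lx; rewrite {s}.
case/lastP: s' => [|s z] in p u lx *; first by rewrite -lx eqxx in xy.
rewrite last_rcons in lx; rewrite {z}lx in p u *.
exists (size s); apply: iter_step_gt0 => //; apply/allP => t ts /=.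
move: u; rewrite /= rcons_uniq mem_rcons in_cons !negb_or.
case/andP => /andP[_ ys] /andP[xs _].
by apply/andP; split; apply: contraTneq ts => ->.
Qed.

(** The constant 1 is the sum of its steps into [{x, y}] and into the complement; iterating this
    bounds the probability of hitting [{x, y}], of which first hits at [x] are a part. *)
Lemma sum_hit_le1 x y n v : x != y ->
  \sum_(0 <= k < n) iter k (step (predC (pred2 x y))) ((trans N)^~ x) v <= 1.
Proof.
move=> xy.
have h1 : (fun=> 1) =1 step (pred2 x y) (fun=> 1) \+
    step (predC (pred2 x y)) (fun=> 1).
  move=> u /=; rewrite stepC /step.
  by under eq_bigr do rewrite !mulr1; rewrite sum_trans.
apply: le_trans (sum_iter_step_le _ _ _ (fun=> ler01) h1 n v).
apply: ler_sum => k _.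
rewrite (eq_iter_step _ (step (pred2 x y) (fun=> 1))
    ((trans N)^~ x \+ (trans N)^~ y)); last first.
  by move=> u /=; rewrite step2// !mul1r.
by rewrite iter_stepD lerDl iter_step_ge0// => u; exact: trans_ge0.
Qed.

Lemma potential_sum_le (o : V) (h : V -> R) x y n : potential N o h -> x != y ->
  h y * (vcond N x * \sum_(0 <= k < n)
    iter k (step (predC (pred2 x y))) ((trans N)^~ y) x) -
  h x * (vcond N x * (1 - \sum_(0 <= k < n)
    iter k (step (predC (pred2 x y))) ((trans N)^~ x) x)) <= 1.
Proof.
case=> h0 ho Lo Lh xy; set D := predC (pred2 x y).
(* By [step_laplacian], [h] is its full step minus [laplacian N h / vcond N]. The unit source at [o]
   gives the coefficient [c]; the part of the step landing on [x] or [y] gives the other two terms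
   of [g]. *)
pose c := - (vcond N o)^-1.
pose g := (fun u => h x * trans N u x) \+ (fun u => h y * trans N u y) \+
          (fun u => c * (u == o)%:R).
have hE : h =1 g \+ step D h.
  move=> u; rewrite /g /= -(step2 h)// addrAC stepC step_laplacian.
  case: (eqVneq u o) => [->|uo] /=; first by rewrite Lo /c; field; rewrite vcond_neq0.
  by rewrite Lh//; field; rewrite vcond_neq0.
have := sum_iter_step_le D h g h0 hE n x.
under eq_bigr => k _ do rewrite /g !iter_stepD !iter_stepZ.
rewrite !big_split -!mulr_sumr /=.
set Ax := \sum_(_ <= _ < _) _; set Ay := \sum_(_ <= _ < _) _.
set G := \sum_(_ <= _ < _) _ => hle.
(* [G] is the expected number of visits to [o] before time [n] and before the
   return to [{x, y}]; by reversibility it is, up to the factor [c_o / c_x], a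
   hitting probability. *)
suff Gle : vcond N x * G <= vcond N o.
  have : vcond N x * (h x * Ax + h y * Ay + c * G) <= vcond N x * h x.
    by rewrite ler_pM2l ?vcond_gt0.
  have : (vcond N o)^-1 * (vcond N x * G) <= (vcond N o)^-1 * vcond N o.
    by rewrite ler_pM2l ?invr_gt0 ?vcond_gt0.
  rewrite mulVf ?vcond_neq0// /c; lra.
(* A visit to [o] at time [k + 1] is a taboo transition to [o], counted only when [o] itself lies in
   [D]. *)
have iter1 k : iter k.+1 (step D) (fun u => (u == o)%:R) x =
    (D o)%:R * iter k (step D) ((trans N)^~ o) x.
  rewrite -iter_stepZ iterSr; apply: eq_iter_step => u.
  rewrite -(step1 (fun w => (D w)%:R)).
  by apply: eq_bigr => w _; rewrite [_%:R * _]mulrC.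
rewrite /G; case: n {Ax Ay G hle} => [|n].
  by rewrite big_nil mulr0 ltW ?vcond_gt0.
rewrite big_nat_recl//; under eq_bigr do rewrite iter1.
(* For [x = o] the visit at time 0 counts 1 and [D o = 0] removes all later ones. Otherwise the term
   at time 0 vanishes, and reversal turns the rest into hits of [x] from [o]. *)
rewrite -mulr_sumr /=; have [xo|xo] := eqVneq x o.
  by rewrite -xo /D /= mul0r addr0 mulr1.
rewrite mulr0n add0r mulrCA mulr_sumr; under eq_bigr do rewrite iter_step_trans_sym.
rewrite -mulr_sumr mulrCA ger_pMr ?vcond_gt0//.
by case: (~~ _); rewrite ?mul0r ?mul1r ?ler01//; exact: sum_hit_le1.
Qed.
End Operators.

Arguments nbhd {R V}.
Arguments step {R V}.

(** * Taboo sums as probabilities of events of the walk *)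

Section Law.
Context (R : realType) (V : choiceType) (N : network R V).
Context (d : measure_display) (T : measurableType d) (W : walk N T).
Implicit Types (D B : pred V) (v : nat -> V) (x y t : V) (E : set T).
Local Open Scope classical_set_scope.

Definition history n v : set T :=
  [set w | forall i, (i <= n)%N -> pos W i w = v i].

Lemma measurable_pos n B : measurable [set w | B (pos W n w)].
Proof. exact: (walk_measurable W n [set t | B t]). Qed.

Lemma measurable_history n v : measurable (history n v).
Proof.
rewrite (_ : history n v =
    \bigcap_(i in [set i | (i <= n)%N]) (pos W i @^-1` [set v i])).
  by apply: bigcap_measurable => [|i _]; [exists 0%N|exact: walk_measurable].
by apply/seteqP; split.
Qed.

(** Only the values up to time [n + 1] matter; the constant tail is filler. *)
Definition extend v n t : nat -> V := fun i => if (i <= n)%N then v i else t.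

Lemma history_extend n v t :
  history n.+1 (extend v n t) = history n v `&` [set w | pos W n.+1 w == t].
Proof.
apply/seteqP; split => w /=.
  move=> hw; split; first by move=> i le_in; rewrite hw /extend ?le_in// ltnW.
  by rewrite hw// /extend ltnn.
case=> hw /eqP wt i; rewrite /extend leq_eqVlt ltnS.
by case: leqP => [/hw//|lt_ni]; rewrite orbF => /eqP ->.
Qed.

Lemma law_history_extend x n v t :
  law W x (history n.+1 (extend v n t)) =
  (law W x (history n v) * (trans N (v n) t)%:E)%E.
Proof.
have := walk_step W x n (extend v n t).
rewrite {3 4}/extend leqnn ltnn => ->; congr (law W x _ * _)%E.
apply/seteqP; split => w /= hw i le_in; move: (hw i le_in);
  by rewrite /extend le_in.
Qed.

Lemma law_fin x E : measurable E -> law W x E \is a fin_num.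
Proof. exact: fin_num_measure. Qed.

Lemma law_split x n (s : seq V) E : uniq s -> measurable E ->
  law W x (E `&` [set w | pos W n w \in s]) =
  (\sum_(t <- s) law W x (E `&` [set w | pos W n w == t]))%E.
Proof.
move=> + mE; elim: s => [|t s IH] /= => [_|/andP[ts /IH {}IH]].
  rewrite big_nil (_ : _ `&` _ = set0) ?measure0//.
  by apply/seteqP; split => w [].
rewrite big_cons -IH -measureU.
- congr (law W x _); apply/seteqP; split => w /=; rewrite in_cons.
    by case=> Ew /orP[]; [left|right].
  by move=> [[Ew ->]|[Ew ->]]; rewrite ?orbT.
- by apply: measurableI => //; exact: (measurable_pos n (pred1 t)).
- by apply: measurableI => //; exact: (measurable_pos n (mem s)).
- apply/seteqP; split => // w [[_ /eqP /= ->] [_]].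
  by rewrite /= (negbTE ts).
Qed.

(** The transition probabilities to the neighbours sum to 1 and so exhaust the mass of the history:
    moving anywhere else is a null event. *)
Lemma law_next x n v E : measurable E ->
  law W x (history n v `&` E) =
  (\sum_(t <- nbhd N (v n)) law W x (history n.+1 (extend v n t) `&` E))%E.
Proof.
move=> mE; have mH := measurable_history n v.
set B := [set w | pos W n.+1 w \in nbhd N (v n)].
have mB : measurable B := measurable_pos n.+1 (mem (nbhd N (v n))).
have null : law W x (history n v `\` B) = 0%E.
  have : law W x (history n v `&` B) = law W x (history n v).
    rewrite law_split ?uniq_nbhd//.
    under eq_bigr do rewrite -history_extend law_history_extend.
    rewrite -(fineK (law_fin x _ mH)); under eq_bigr do rewrite -EFinM.
    by rewrite sumEFin -mulr_sumr sum_trans mulr1.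
  have : law W x (history n v) =
      (law W x (history n v `\` B) + law W x (history n v `&` B))%E.
    exact: measureDI.
  move=> /[swap] ->.
  rewrite -(fineK (law_fin x _ mH)) -(fineK (law_fin x _ (measurableD mH mB))).
  by rewrite -EFinD => -[e]; congr _%:E; lra.
have mHE := measurableI _ _ mH mE.
have -> : law W x (history n v `&` E) =
    (law W x ((history n v `&` E) `\` B) +
     law W x ((history n v `&` E) `&` B))%E by exact: measureDI.
rewrite [X in (X + _)%E](_ : _ = 0%E) ?add0e; last first.
  apply: (subset_measure0 _ _ _ null); first exact: measurableD.
    exact: measurableD.
  by move=> w [[? ?] ?].
rewrite law_split ?uniq_nbhd//.
by apply: eq_bigr => t _; rewrite history_extend setIAC.
Qed.

(** [k] counts the positions required to lie in [D]; the visit to [B] is at time [n + k + 1], so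
    [k = 0] already means one step. *)
Definition taboo_hit n k D B : set T :=
  [set w | (forall i, (i < k)%N -> D (pos W (n + i).+1 w)) /\
           B (pos W (n + k).+1 w)].

Lemma measurable_taboo_hit n k D B : measurable (taboo_hit n k D B).
Proof.
rewrite (_ : taboo_hit n k D B =
    (\bigcap_i [set w | ((i < k)%N ==> D (pos W (n + i).+1 w))]) `&`
    [set w | B (pos W (n + k).+1 w)]).
  apply: measurableI; last exact: measurable_pos.
  apply: bigcapT_measurable => i.
  exact: (measurable_pos _ (fun t => (i < k)%N ==> D t)).
apply/seteqP; split => w /= [Dw Bw]; split => // i.
  by move=> _; apply/implyP/Dw.
exact/implyP/Dw.
Qed.

(** Markov property, by induction on [k]. Conditioning on the position at time [n + 1] lengthens the
    history, hence the generality in [n] and [v]. *)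
Lemma law_taboo_hit x n k v D B :
  law W x (history n v `&` taboo_hit n k D B) =
  (law W x (history n v) * (iter k (step N D) (step N B (fun=> 1)) (v n))%:E)%E.
Proof.
have posE m u t w : history m.+1 (extend u m t) w -> pos W m.+1 w = t.
  by rewrite history_extend => -[_ /eqP].
elim: k n v => [|k IH] n v.
(* The base case and the induction step share the expansion over the next position [t]; they differ
   in what is then asked of [t]. *)
all: rewrite law_next; last exact: measurable_taboo_hit.
all: have /fineK Hv := law_fin x _ (measurable_history n v).
all: rewrite /= [step _ _ _ (v n)]/step -[in RHS]Hv -EFinM mulr_sumr -sumEFin.
all: apply: eq_bigr => t _; rewrite (mulrA (fine _)) EFinM [X in (X * _)%E]EFinM Hv.
all: rewrite -law_history_extend.
  case: (boolP (B t)) => Bt.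
    rewrite mulr1 mule1; congr (law W x _); apply/seteqP; split => w /=; first by case.
    by move=> hw; split => //; split => //; rewrite addn0 (posE _ _ _ _ hw).
  rewrite mul0r mule0 (_ : _ `&` _ = set0) ?measure0//.
  apply/seteqP; split => // w [hw [_ /=]].
  by rewrite addn0 (posE _ _ _ _ hw) (negbTE Bt).
case: (boolP (D t)) => Dt.
  have := IH n.+1 (extend v n t); rewrite {3}/extend ltnn mul1r => <-.
  (* Moving the time origin from [n] to [n + 1] turns the requirement at index 0 into [D t] and
     shifts the others by one. *)
  congr (law W x _); apply/seteqP; split => w [hw [Dw Bw]]; split => //; split.
  - by move=> i ik; rewrite addSnnS; exact: Dw.
  - by rewrite addSnnS.
  - move=> [|i] ik; first by rewrite addn0 (posE _ _ _ _ hw).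
    by rewrite -addSnnS; exact: Dw.
  - by rewrite -addSnnS.
rewrite mul0r mule0 (_ : _ `&` _ = set0) ?measure0//.
apply/seteqP; split => // w [hw [/(_ 0%N isT)]].
by rewrite addn0 (posE _ _ _ _ hw) (negbTE Dt).
Qed.

Lemma law_start x E : measurable E -> law W x (history 0 (fun=> x) `&` E) = law W x E.
Proof.
move=> mE; have mH := measurable_history 0 (fun=> x).
have H1 : law W x (history 0 (fun=> x)) = 1%E.
  rewrite -(walk_start W x); congr (law W x _).
  apply/seteqP; split => w /= hw; first exact: hw.
  by move=> i; rewrite leqn0 => /eqP ->.
have -> : law W x E = (law W x (E `\` history 0 (fun=> x)) +
    law W x (E `&` history 0 (fun=> x)))%E by exact: measureDI.
rewrite [X in (X + _)%E](_ : _ = 0%E) ?add0e 1?setIC//.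
have HC0 : law W x (~` history 0 (fun=> x)) = 0%E.
  by rewrite probability_setC// H1 subee.
apply: (subset_measure0 _ _ _ HC0); [exact: measurableD|exact: measurableC|].
by move=> w [].
Qed.

(** The events [taboo_hit 0 k D B] are disjoint, since an earlier visit to [B] breaks the stay in
    [D]; countable additivity gives the limit. The description of [E] is asked only on paths from
    [x], which carry all the mass. *)
Lemma cvg_taboo_hit x D B E : (forall t, B t -> ~~ D t) -> measurable E ->
  (forall w, pos W 0 w = x -> E w <-> exists k, taboo_hit 0 k D B w) ->
  \sum_(0 <= k < n) iter k (step N D) (step N B (fun=> 1)) x @[n --> \oo] -->
  fine (law W x E).
Proof.
move=> BD mE hE.
suff : (\sum_(0 <= k < n) (iter k (step N D) (step N B (fun=> 1)) x)%:E)%E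
    @[n --> \oo] --> (fine (law W x E))%:E.
  by under eq_fun do rewrite sumEFin; move/fine_cvg.
rewrite fineK ?law_fin//.
pose F k := history 0 (fun=> x) `&` taboo_hit 0 k D B.
have mF k : measurable (F k).
  by apply: measurableI; [exact: measurable_history|exact: measurable_taboo_hit].
have lawF k : law W x (F k) = (iter k (step N D) (step N B (fun=> 1)) x)%:E.
  rewrite law_taboo_hit -[history 0 _]setIT law_start//.
  by rewrite probability_setT mul1e.
have -> : law W x E = law W x (\bigcup_k F k).
  rewrite -(law_start _ _ mE); congr (law W x _).
  apply/seteqP; split => w [].
    by move=> hw /hE[|k]; [exact: hw|exists k].
  move=> k _ [hw hk]; split => //; apply/hE; first exact: hw.
  by exists k.
have trF : trivIset setT F.
  apply/trivIsetP => i j _ _ ij; apply/seteqP; split => // w [[_ [Di Bi]] [_ [Dj Bj]]].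
  case: (ltngtP i j) ij => // ij _.
    by have := BD _ Bi; rewrite Dj.
  by have := BD _ Bj; rewrite Di.
have := @measure_semi_sigma_additive _ _ _ (law W x) F mF trF (bigcup_measurable (fun k _ => mF k)).
apply: cvg_trans; apply: near_eq_cvg; near=> n.
by apply: eq_bigr => k _; rewrite -lawF.
Unshelve. all: by end_near.
Qed.

(** * Hitting and return times, and their laws as limits of taboo sums *)

Lemma first_time_lty (S : set nat) : (first_time R S < +oo)%E <-> exists n, S n.
Proof.
split=> [/ereal_inf_lt[_ [n Sn _] _]|[n Sn]]; first by exists n.
by apply: le_lt_trans (ltry n%:R); apply: ereal_inf_lbound; exists n.
Qed.

Lemma first_time_lt (S S' : set nat) : (first_time R S < first_time R S')%E <->
  exists2 n, S n & forall m, S' m -> (n < m)%N.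
Proof.
split=> [/ereal_inf_lt[_ [n Sn <-] nS']|[n Sn nS']].
  exists n => // m S'm; rewrite -(ltr_nat R) -lte_fin.
  by apply: lt_le_trans nS' _; apply: ereal_inf_lbound; exists m.
apply: (@le_lt_trans _ _ n%:R%:E); first by apply: ereal_inf_lbound; exists n.
(* [n + 1] separates the two infima, also when [S'] is empty and its infimum is [+oo]. *)
apply: (@lt_le_trans _ _ n.+1%:R%:E); first by rewrite lte_fin ltr_nat.
by apply: le_ereal_inf_tmp => _ [m S'm <-]; rewrite lee_fin ler_nat; exact: nS'.
Qed.

Lemma cvg_hit_before_return x y : x != y ->
  \sum_(0 <= k < n) iter k (step N (predC (pred2 x y))) ((trans N)^~ x) y
    @[n --> \oo] -->
  fine (law W y [set w | (hit_time W x w < return_time W y w)%E]).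
Proof.
move=> xy; set E := [set w | _].
(* This form involves countably many conditions on single positions, which yields measurability. *)
have EE : E = \bigcup_n ([set w | pos W n w == x] `&`
    \bigcap_m [set w | (0 < m <= n)%N ==> (pos W m w != y)]).
  apply/seteqP; split => w.
    move=> /first_time_lt[n xn ny]; exists n => //; split; first exact/eqP.
    move=> m _ /=; apply/implyP => /andP[m0 mn]; apply/eqP => my.
    by have := ny m (conj m0 my); rewrite ltnNge mn.
  move=> [n _ [/eqP xn yn]]; apply/first_time_lt; exists n => // m [m0 my].
  by have := yn m I; rewrite /= m0 my eqxx; case: leqP.
have mE : measurable E.
  rewrite EE; apply: bigcupT_measurable => n; apply: measurableI.
    exact: (measurable_pos n (pred1 x)).
  apply: bigcapT_measurable => m.
  exact: (measurable_pos m (fun t => (0 < m <= n)%N ==> (t != y))).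
have -> : (fun n => \sum_(0 <= k < n)
      iter k (step N (predC (pred2 x y))) ((trans N)^~ x) y) =
    (fun n => \sum_(0 <= k < n)
      iter k (step N (predC (pred2 x y))) (step N (pred1 x) (fun=> 1)) y).
  apply/funext => n; apply: eq_bigr => k _; apply: eq_iter_step => t.
  by rewrite step1 mul1r.
apply: cvg_taboo_hit => //= [t /eqP ->|w wy]; first by rewrite eqxx.
rewrite EE; split=> [[n _ [/= /eqP nx ny]]|[k [/= Dk /eqP kx]]].
  have exn : exists n, pos W n w == x by exists n; apply/eqP.
  (* The least visit time to [x] is positive because the walk starts at [y]. Written [m + 1], it
     leaves the times from 1 to [m] free of [x], and of [y] too since [m + 1 <= n]. *)
  case: (ex_minnP exn) => -[|m] /eqP mx mmin.
    by rewrite -mx wy eqxx in xy.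
  exists m; split => [i im|] /=; last exact/eqP.
  rewrite add0n negb_or; apply/andP; split.
    by apply/negP => /mmin; rewrite ltnNge im.
  have := ny i.+1 I; rewrite /= => /implyP; apply.
  by rewrite (leq_trans im)// -ltnS ltnW// ltnS mmin//; apply/eqP.
exists k.+1 => //; split => /=; first exact/eqP.
move=> m _ /=; apply/implyP => /andP[]; case: m => // m _.
rewrite leq_eqVlt => /orP[/eqP[->]|mk]; first by rewrite kx.
by have := Dk m mk; rewrite negb_or => /andP[].
Qed.

(** Recurrence makes a return to [x], hence a visit to [{x, y}] at a positive time, almost sure; the
    first such visit is at [x] or at [y], which splits the sum in two. *)
Lemma cvg_hit_or_return x y : recurrent W -> x != y ->
  \sum_(0 <= k < n) iter k (step N (predC (pred2 x y))) ((trans N)^~ x) x +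
  \sum_(0 <= k < n) iter k (step N (predC (pred2 x y))) ((trans N)^~ y) x
    @[n --> \oo] --> (1 : R).
Proof.
move=> hrec xy.
pose E := \bigcup_n [set w | pred2 x y (pos W n.+1 w)].
have mE : measurable E.
  by apply: bigcupT_measurable => n; exact: (measurable_pos n.+1 (pred2 x y)).
have mR : measurable [set w | (return_time W x w < +oo)%E].
  rewrite (_ : [set w | _] = \bigcup_n [set w | pred1 x (pos W n.+1 w)]).
    by apply: bigcupT_measurable => n; exact: (measurable_pos n.+1 (pred1 x)).
  apply/seteqP; split => w.
    by move=> /first_time_lty[[|n] [//= _ nx]]; exists n => //=; apply/eqP.
  by move=> [n _ /eqP nx]; apply/first_time_lty; exists n.+1.
have E1 : law W x E = 1%E.
  apply/eqP; rewrite eq_le probability_le1//= -(hrec x).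
  apply: le_measure; [exact: mem_set mR|exact: mem_set mE|].
  move=> w /first_time_lty[[|n] [//= _ nx]].
  by exists n => //=; rewrite nx eqxx.
have hE w : pos W 0 w = x ->
    E w <-> exists k, taboo_hit 0 k (predC (pred2 x y)) (pred2 x y) w.
  move=> _; split=> [[n _ hn]|[k [_ hk]]]; last by exists k.
  have exn : exists n, pred2 x y (pos W n.+1 w) by exists n.
  case: (ex_minnP exn) => m hm mmin; exists m; split => // i im.
  by apply/negP => /mmin; rewrite leqNgt im.
have BD t : pred2 x y t -> ~~ predC (pred2 x y) t by rewrite /= negbK.
have := cvg_taboo_hit x _ _ E BD mE hE.
rewrite E1 [fine _]/=; apply: cvg_trans.
apply: near_eq_cvg; near=> n; rewrite -big_split; apply: eq_bigr => k _ /=.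
rewrite -iter_stepD; apply: eq_iter_step => t.
by rewrite step2//= !mul1r.
Unshelve. all: by end_near.
Qed.

(** * The effective conductance [escape], inverse to [Reff] off the diagonal *)

Definition escape x y : R := vcond N y *
  fine (law W y [set w | (hit_time W x w < return_time W y w)%E]).

Lemma cvg_escape x y : x != y ->
  vcond N y * (\sum_(0 <= k < n)
    iter k (step N (predC (pred2 x y))) ((trans N)^~ x) y) @[n --> \oo] -->
  escape x y.
Proof. by move=> xy; apply: cvgMl_tmp; exact: cvg_hit_before_return. Qed.

Lemma pred2C x y : pred2 x y = pred2 y x.
Proof. by congr SimplPred; apply/funext => t /=; rewrite orbC. Qed.

(** The approximating sums agree term by term by reversibility, so their limits coincide. *)
Lemma escapeC x y : x != y -> escape x y = escape y x.
Proof.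
move=> xy; have yx : y != x by rewrite eq_sym.
apply: (cvg_unique (@norm_hausdorff _ R) (cvg_escape _ _ xy)).
have := cvg_escape _ _ yx; rewrite pred2C; apply: cvg_trans.
apply: near_eq_cvg; near=> n; rewrite !mulr_sumr; apply: eq_bigr => k _.
exact: iter_step_trans_sym.
Unshelve. all: by end_near.
Qed.

(** A simple path from [y] to [x] makes one term of the nonnegative series positive. *)
Lemma escape_gt0 x y : x != y -> 0 < escape x y.
Proof.
move=> xy; have [m am] := exists_iter_step_gt0 _ _ N x y xy.
set a := iter m _ _ _ in am.
have : 0 < vcond N y * a by rewrite mulr_gt0 ?vcond_gt0.
move=> /lt_le_trans; apply; apply: (cvgr_to_ge (cvg_escape _ _ xy)).
near=> n; rewrite ler_pM2l ?vcond_gt0//.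
have mn : (m < n)%N by near: n; exact: nbhs_infty_gt.
rewrite (bigD1_seq m) ?mem_index_iota ?iota_uniq//= lerDl.
by apply: sumr_ge0 => k _; apply: iter_step_ge0 => u; exact: trans_ge0.
Unshelve. all: by end_near.
Qed.

Lemma potential_sub_le (o : V) (h : V -> R) x y : recurrent W ->
  potential N o h -> x != y -> (h y - h x) * escape x y <= 1.
Proof.
move=> hrec hpot xy; have yx : y != x by rewrite eq_sym.
have cy := cvg_escape _ _ yx; rewrite pred2C -(escapeC _ _ xy) in cy.
pose A t n :=
  \sum_(0 <= k < n) iter k (step N (predC (pred2 x y))) ((trans N)^~ t) x.
(* By recurrence [A x n + A y n] tends to 1, so [1 - A x n] has the same limit as [A y n]. *)
have cx : vcond N x * (1 - A x n) @[n --> \oo] --> escape x y.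
  have -> : (fun n => vcond N x * (1 - A x n)) =
      (fun n => vcond N x * (1 - (A x n + A y n)) + vcond N x * A y n).
    by apply/funext => n; ring.
  rewrite -[escape x y]add0r -(mulr0 (vcond N x)) -(subrr (1 : R)).
  apply: cvgD cy; apply: cvgMl_tmp; apply: cvgB; first exact: cvg_cst.
  exact: (cvg_hit_or_return x y hrec xy).
rewrite mulrBl; apply: (cvgr_to_le (cvgB (cvgMl_tmp (a := h y) cy) (cvgMl_tmp (a := h x) cx))).
by near=> n; exact: (potential_sum_le _ _ _ _ _ _ _ n hpot xy).
Unshelve. all: by end_near.
Qed.
End Law.

Theorem corollary2p13 (R : realType) (V : choiceType) (N : network R V) (o : V)
  (d : measure_display) (T : measurableType d) (W : walk N T)
  (hrec : recurrent W) (h : V -> R) (hpot : potential N o h) (x y : V) :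
  `|h x - h y| <= Reff W x y.
Proof.
rewrite /Reff; case: eqVneq => [->|xy]; first by rewrite subrr normr0.
have yx : y != x by rewrite eq_sym.
have q0 := escape_gt0 _ _ _ _ _ W _ _ xy.
rewrite -/(escape _ _ _ _ _ W x y) -[_^-1]mul1r ler_pdivlMr//.
(* With the positive conductance moved inside the absolute value, the two one-sided bounds are
   [potential_sub_le] for [(x, y)] and, after [escapeC], for [(y, x)]. *)
rewrite -[X in `|_| * X]gtr0_norm// -normrM ler_norml.
rewrite lerNl -mulNr opprB (potential_sub_le _ _ _ _ _ _ _ _ _ _ hrec hpot xy) /=.
rewrite escapeC//.
exact: (potential_sub_le _ _ _ _ _ _ _ _ _ _ hrec hpot yx).
Qed.
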